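(* Let $P$ and $\tilde P$ be Markov semigroups on measurable spaces $(V,\mathcal V)$ and $(\tilde V,\tilde{\mathcal V})$ with invariant probability measures $\nu$ and $\tilde\nu$ respectively. Assume that $P$ has an interweaving relation with $\tilde P$ with warm-up time $\tau$ and kernels $\Lambda,\tilde\Lambda$, with $\tilde\nu=\nu\Lambda$ and $\nu=\tilde\nu\tilde\Lambda$. Assume that there is a constant $\tilde\alpha>0$ such that for all $t\ge0$ $$\|\tilde P_t\|_{\mathbf L^2(\tilde\nu)\to\mathbf L^{p(\tilde\alpha t)}(\tilde\nu)}\le1,\qquad p(\tilde\alpha t):=1+\exp(\tilde\alpha t).$$ Then for all $t\ge0$ $$\|P_{t+\tau}\|_{\mathbf L^2(\nu)\to\mathbf L^{p(\tilde\alpha t)}(\nu)}\le1.$$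
   Context: A Markov semigroup on a measurable space $(V,\mathcal V)$ is a family $P=(P_t)_{t\ge0}$ of Markov (probability) kernels from $V$ to $V$ such that $(t,x)\mapsto P_t(x,A)$ is measurable for every $A\in\mathcal V$ and $P_tP_s=P_{t+s}$ for all $s,t\ge0$. A kernel acts on functions by $\Lambda f(x)=\int f(y)\Lambda(x,dy)$ and on probability measures by $m\Lambda(A)=\int m(dx)\Lambda(x,A)$. $P$ has an interweaving relation with $\tilde P$ with warm-up time $\tau$ (a non-negative random variable) and Markov kernels $\Lambda$ (from $V$ to $\tilde V$), $\tilde\Lambda$ (from $\tilde V$ to $V$) if for all $t\ge0$ $$P_t\Lambda=\Lambda\tilde P_t,\qquad \tilde P_t\tilde\Lambda=\tilde\Lambda P_t,\qquad \Lambda\tilde\Lambda=P_\tau:=\int_0^\infty P_s\,\mathbb P(\tau\in ds).$$ Moreover $P_{t+\tau}:=\int_0^\infty P_{t+s}\,\mathbb P(\tau\in ds)$. The norms in the claim are operator norms. *)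

(* Defs.v *)
From HB Require Import structures.
From mathcomp Require Import all_boot all_order all_algebra.
From mathcomp Require Import all_classical all_reals all_analysis.
From mathcomp Require Import measurable_realfun.

Set Implicit Arguments.
Unset Strict Implicit.
Unset Printing Implicit Defensive.
Import Order.TTheory GRing.Theory Num.Theory.
Import numFieldTopology.Exports.

Local Open Scope classical_set_scope.
Local Open Scope ring_scope.
Local Open Scope ereal_scope.

Definition kernel_fun {d d'} {X : measurableType d} {Y : measurableType d'}
    {R : realType} (k : X -> {measure set Y -> \bar R}) (f : Y -> R) (x : X) :
    \bar R :=
  \int[k x]_y (f y)%:E.

Definition measure_kernel {d d'} {X : measurableType d} {Y : measurableType d'}
    {R : realType} (m : {measure set X -> \bar R})
    (k : X -> {measure set Y -> \bar R}) (A : set Y) : \bar R :=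
  \int[m]_x k x A.

(* The kernels at times t < 0 are unconstrained junk, and P_0 = Id is not
   required. Identities between kernels are asserted on measurable sets only,
   library measures being unconstrained elsewhere. *)
Record markov_semigroup {d} (V : measurableType d) (R : realType) := {
  semigroup_kernel :> R -> R.-pker V ~> V ;
  semigroup_measurable : forall A : set V, measurable A ->
    measurable_fun
      ((`[0%R, +oo[ : set (measurableTypeR R)) `*` [set: V])
      (fun tx : measurableTypeR R * V =>
        semigroup_kernel tx.1 tx.2 A : \bar R) ;
  semigroup_comp : forall t s : R, (0 <= t)%R -> (0 <= s)%R ->
    forall x A, measurable A ->
    kcomp_noparam (semigroup_kernel t) (semigroup_kernel s) x A =
    semigroup_kernel (t + s)%R x A }.

Definition invariant_measure {d} {V : measurableType d} {R : realType}
    (P : markov_semigroup V R) (nu : probability V R) : Prop :=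
  forall t : R, (0 <= t)%R ->
  forall A, measurable A -> measure_kernel nu (P t) A = nu A.

(* The kernel P_{t + tau}, as a family of measures. *)
Section shifted_kernel.
Context {d d0} {V : measurableType d} {Omega : measurableType d0}
  {R : realType}.
Variables (P : markov_semigroup V R) (Pr : probability Omega R)
  (tau : {RV Pr >-> R}) (t : R) (t0 : (0 <= t)%R).

Definition shifted_set_fun of (0 <= t)%R := fun (x : V) (A : set V) =>
  \int[distribution Pr tau]_(s in `[0%R, +oo[) P (t + s)%R x A.

Local Notation Q := (shifted_set_fun t0).

Let meas x A : measurable A ->
  measurable_fun (`[0%R, +oo[%classic : set (measurableTypeR R))
    (fun s => P (t + s)%R x A).
Proof.
move=> mA.
have -> : (fun s => P (t + s)%R x A) =
    (fun tx : measurableTypeR R * V => P tx.1 tx.2 A) \o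
    (fun s : measurableTypeR R => ((t + s)%R : measurableTypeR R, x)) by [].
apply: (measurable_comp _ _ (semigroup_measurable P mA)).
- by apply: measurableX.
- move=> y [s /=]; rewrite in_itv/= andbT => s0 <-; split => //=.
  by rewrite in_itv/= andbT addr_ge0.
- apply: measurable_funTS; apply/measurable_fun_pairP; split.
  + exact: measurable_funD.
  + exact: measurable_cst.
Qed.

Let Q0 x : Q x set0 = 0.
Proof. by rewrite /shifted_set_fun integral0_eq. Qed.

Let Q_ge0 x A : 0 <= Q x A.
Proof. exact: integral_ge0. Qed.

Let Q_additive x : semi_sigma_additive (Q x).
Proof.
move=> F mF tF mUF; rewrite [X in _ --> X](_ : _ =
  \sum_(0 <= n <oo) Q x (F n)).
  by apply: is_cvg_nneseries => n _ _; exact: Q_ge0.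
rewrite /shifted_set_fun -integral_nneseries//=.
- by apply: eq_integral => s _; rewrite measure_semi_bigcup.
- by move=> n; exact: meas.
Qed.

HB.instance Definition _ x := isMeasure.Build _ _ R (Q x) (Q0 x) (Q_ge0 x)
  (@Q_additive x).

Definition shifted_kernel : V -> {measure set V -> \bar R} := Q.

End shifted_kernel.
Arguments shifted_kernel {d d0 V Omega R} P {Pr} tau {t} t0.

Record interweaving {d d' d0} {V : measurableType d} {V' : measurableType d'}
    {Omega : measurableType d0} {R : realType}
    (P : markov_semigroup V R) (P' : markov_semigroup V' R)
    {Pr : probability Omega R} (tau : {RV Pr >-> R})
    (L : R.-pker V ~> V') (L' : R.-pker V' ~> V) : Prop := {
  interweaving_nonneg : forall w, (0 <= tau w)%R ;
  interweaving_left : forall t : R, (0 <= t)%R ->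
    forall x A, measurable A ->
    kcomp_noparam (P t) L x A = kcomp_noparam L (P' t) x A ;
  interweaving_right : forall t : R, (0 <= t)%R ->
    forall x A, measurable A ->
    kcomp_noparam (P' t) L' x A = kcomp_noparam L' (P t) x A ;
  interweaving_warmup : forall x A, measurable A ->
    kcomp_noparam L L' x A =
    \int[distribution Pr tau]_(s in `[0%R, +oo[) P s x A }.

(* Norm of f |-> k f from L^p(mu) to L^q(nu), as a supremum over the closed
   unit ball of real-valued functions. When nu k = mu and p >= 1, the integral
   defining (k f)(x) converges for nu-almost every x and k f only depends on
   the class of f, up to nu-negligible sets; the other x do not affect the
   L^q(nu)-norm of k f. *)
Definition operator_norm {d d'} {X : measurableType d} {Y : measurableType d'}
    {R : realType} (mu : {measure set Y -> \bar R}) (p : \bar R)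
    (nu : {measure set X -> \bar R}) (q : \bar R)
    (k : X -> {measure set Y -> \bar R}) : \bar R :=
  ereal_sup [set 'N[nu]_q[kernel_fun k f] |
    f in [set f : Y -> R | f \in Lfun mu p /\ 'N[mu]_p[EFin \o f] <= 1]].

Definition hyper_exponent {R : realType} (u : R) : R := (1 + expR u)%R.

(* Main.v *)
(* The interweaving relation factors the shifted semigroup as
   P_{t + tau} = P_t L L' = L P'_t L'. A Markov kernel is a contraction from
   L^r of the image measure to L^r by Jensen's inequality, so the norm of
   P_{t + tau} from L^2(nu) to L^p(nu) is at most
   |L|_{p -> p} |P'_t|_{2 -> p} |L'|_{2 -> 2} <= 1. The hypothesis on P'_t only
   speaks about real-valued functions, whereas L' f may be infinite or undefined
   somewhere: the factorization is applied to bounded nonnegative functions, and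
   monotone convergence gives the general case. *)

Require Import Defs.
From HB Require Import structures.
From mathcomp Require Import all_boot all_order all_algebra.
From mathcomp Require Import all_classical all_reals all_analysis.
From mathcomp Require Import measurable_realfun.
From mathcomp Require Import giry.

Import Order.TTheory GRing.Theory Num.Theory.

Local Open Scope classical_set_scope.
Local Open Scope ring_scope.
Local Open Scope ereal_scope.

(** * Integration against mixtures of kernels *)

Section kernel_giry.
Context {d d'} {X : measurableType d} {Y : measurableType d'} {R : realType}.
Variable k : R.-spker X ~> Y.

(** An alias of [k] that carries the sub-probability instance, so that each measure [k x] becomes a
    point of the Giry space [giry Y R]. *)
Definition kernel_giry (x : X) : set Y -> \bar R := k x.

HB.instance Definition _ x := Measure.copy (kernel_giry x) (k x).
HB.instance Definition _ x := Measure_isSubProbability.Build _ _ _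
  (kernel_giry x) (sprob_kernel_le1 k x).

(** The sigma-algebra of [giry Y R] is generated by the evaluations at measurable sets, and these
    turn the map into the functions [k ^~ B]. *)
Lemma measurable_kernel_giry :
  measurable_fun [set: X] (kernel_giry : X -> giry Y R).
Proof.
by apply: measurable_giry_codensity => // B mB; exact: measurable_kernel.
Qed.

(** On measurable sets [M] is the monadic bind of [m] along [k], and integrals against a bind are
    iterated integrals. *)
Lemma ge0_integral_mixture (m : giry X R) (M : {measure set Y -> \bar R}) :
  (forall A, measurable A -> M A = \int[m]_x k x A) ->
  forall f : Y -> \bar R, measurable_fun [set: Y] f -> (forall y, 0 <= f y) ->
  \int[M]_y f y = \int[m]_x \int[k x]_y f y.
Proof.
move=> ME f mf f0.
transitivity (giry_int (giry_bind m measurable_kernel_giry) f).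
  apply: eq_measure_integral => A mA _; rewrite ME//.
  by rewrite /giry_bind/= giry_int_map//; exact: measurable_giry_ev.
by rewrite giry_int_bind.
Qed.

End kernel_giry.

(** * Powers, norms and Jensen's inequality *)

Section poweR_Lnorm.
Context {d} {T : measurableType d} {R : realType}.
Variable mu : {measure set T -> \bar R}.
Implicit Types (f g : T -> \bar R) (r : R).

Lemma ge0_le_poweR r (x y : \bar R) : (0 <= r)%R -> 0 <= x -> x <= y ->
  x `^ r <= y `^ r.
Proof.
move=> r0 x0 xy; apply: gt0_ler_poweR => //; rewrite in_itv/= ?x0 ?leey//.
by rewrite (le_trans x0).
Qed.

Lemma measurable_abse_poweR r f : measurable_fun [set: T] f ->
  measurable_fun [set: T] (fun x => `|f x| `^ r).
Proof.
move=> mf; apply: (measurableT_comp (measurable_poweR r)).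
exact: measurableT_comp.
Qed.

Lemma le_Lnorm r f g : (0 <= r)%R ->
  measurable_fun [set: T] f -> measurable_fun [set: T] g ->
  (forall x, `|f x| <= `|g x|) ->
  'N[mu]_r%:E[f] <= 'N[mu]_r%:E[g].
Proof.
move=> r0 mf mg fg; rewrite unlock; apply: ge0_le_poweR.
- by rewrite invr_ge0.
- by apply: integral_ge0 => x _; exact: poweR_ge0.
- apply: ge0_le_integral => //; try exact: measurable_abse_poweR.
  + by move=> x _; exact: poweR_ge0.
  + by move=> x _; exact: ge0_le_poweR.
Qed.

(** Removes the outer root from a unit-ball condition, leaving an integral to which monotone
    convergence applies. *)
Lemma Lnorm_le1 r f : (0 < r)%R ->
  ('N[mu]_r%:E[f] <= 1) = (\int[mu]_x `|f x| `^ r <= 1).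
Proof.
move=> r0; rewrite -(poweR_Lnorm _ _ (lt0r_neq0 r0)).
apply/idP/idP => N1.
  rewrite -(poweR1r r).
  by apply: ge0_le_poweR => //; [exact: ltW|exact: Lnorm_ge0].
rewrite -(poweR1r r^-1) -[leLHS](poweRe1 (Lnorm_ge0 mu r%:E f)).
rewrite -[X in _ `^ X <= _](mulfV (lt0r_neq0 r0)) poweRrM.
apply: ge0_le_poweR => //.
- by rewrite invr_ge0 ltW.
- exact: poweR_ge0.
Qed.

(** Jensen's inequality, from Hölder's inequality for [f] and the constant 1 with conjugate exponent
    [r / (r - 1)]: total mass 1 gives the constant norm 1. *)
Lemma poweR_integral_le r (f : T -> R) : mu [set: T] = 1 -> (1 < r)%R ->
  measurable_fun [set: T] f ->
  (\int[mu]_x `|(f x)%:E|) `^ r <= \int[mu]_x `|(f x)%:E| `^ r.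
Proof.
move=> mu1 r1 mf; have r0 : (0 < r)%R by rewrite (lt_trans _ r1).
rewrite -(poweR_Lnorm mu (EFin \o f) (lt0r_neq0 r0)).
apply: ge0_le_poweR; [exact: ltW|by apply: integral_ge0|].
have := @hoelder _ T R mu f (cst 1%R) r (r / (r - 1))%R mf.
rewrite Lnorm1 (_ : 'N[mu]_(r / (r - 1))%:E[EFin \o cst 1%R] = 1); last first.
  rewrite (_ : EFin \o cst 1%R = cst 1)//.
  by rewrite Lnorm_cst1 [X in X `^ _]mu1 poweR1r.
rewrite mule1; under eq_integral do rewrite /= mulr1.
apply => //; first by rewrite divr_gt0// subr_gt0.
by rewrite invf_div -{1}(div1r r) -mulrDl addrC subrK mulfV// gt_eqF.
Qed.

End poweR_Lnorm.

(** * Action of Markov kernels on functions *)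

Section kernel_fun.
Context {d d'} {X : measurableType d} {Y : measurableType d'} {R : realType}.

Lemma kernel_fun_ge0 (k : X -> {measure set Y -> \bar R}) (f : Y -> R) x :
  (forall y, 0 <= f y)%R -> 0 <= kernel_fun k f x.
Proof. by move=> f0; apply: integral_ge0 => y _; rewrite lee_fin. Qed.

Lemma measurable_kernel_fun (k : X -> {measure set Y -> \bar R}) (f : Y -> R) :
  (forall A, measurable A -> measurable_fun [set: X] (k ^~ A)) ->
  measurable_fun [set: Y] f -> measurable_fun [set: X] (kernel_fun k f).
Proof.
move=> mk /measurable_EFinP mf.
under [X in measurable_fun _ X]eq_fun do rewrite /kernel_fun integralE.
apply: emeasurable_funB; apply: measurable_fun_integral_kernel => //.
- exact: measurable_funepos.
- exact: measurable_funeneg.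
Qed.

Variable k : R.-pker X ~> Y.

Lemma kernel_fun_le (f : Y -> R) (c : R) x : measurable_fun [set: Y] f ->
  (forall y, 0 <= f y <= c)%R -> kernel_fun k f x <= c%:E.
Proof.
move=> mf f0c; rewrite -[leRHS]mule1 -(prob_kernel (s := k) x).
rewrite -integral_cst//; apply: ge0_le_integral => //.
- by move=> y _; rewrite lee_fin; case/andP: (f0c y).
- exact/measurable_EFinP.
- by move=> y _; rewrite lee_fin; case/andP: (f0c y).
Qed.

(** Mass 1 preserves the bounds, so the values are finite and [fine] loses nothing. The real-valued
    [h] can then be fed to a further kernel. *)
Lemma bounded_kernel_fun (f : Y -> R) (c : R) : measurable_fun [set: Y] f ->
  (forall y, 0 <= f y <= c)%R ->
  exists h : X -> R, [/\ measurable_fun [set: X] h,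
    forall x, (0 <= h x <= c)%R & kernel_fun k f = EFin \o h].
Proof.
move=> mf f0c.
have k0 x : 0 <= kernel_fun k f x.
  by apply: kernel_fun_ge0 => y; case/andP: (f0c y).
have kc x := kernel_fun_le f c x mf f0c.
have kfin x : kernel_fun k f x \is a fin_num.
  by rewrite ge0_fin_numE// (le_lt_trans (kc x))// ltry.
have kE : kernel_fun k f = EFin \o (fine \o kernel_fun k f).
  by apply/funext => x /=; rewrite fineK.
exists (fine \o kernel_fun k f); split => //.
- apply/measurable_EFinP; rewrite -kE; apply: measurable_kernel_fun => // A.
  exact: measurable_kernel.
- by move=> x; rewrite -!lee_fin /= fineK// k0 kc.
Qed.

(** Jensen's inequality for each [k x] bounds the [r]-th power of [|k f|] by [k] applied to that of
    [|f|]; integrating in [nu] produces the integral against the image measure [nu']. *)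
Lemma Lnorm_kernel_fun_le (nu : giry X R) (nu' : {measure set Y -> \bar R})
    (r : R) (f : Y -> R) :
  (forall A, measurable A -> nu' A = measure_kernel nu k A) ->
  (1 < r)%R -> measurable_fun [set: Y] f ->
  'N[nu]_r%:E[kernel_fun k f] <= 'N[nu']_r%:E[EFin \o f].
Proof.
move=> nuk r1 mf; have r0 : (0 <= r)%R by rewrite ltW// (lt_trans _ r1).
have mf' : measurable_fun [set: Y] (EFin \o f) by exact/measurable_EFinP.
have mfr := measurable_abse_poweR r _ mf'.
rewrite unlock; apply: ge0_le_poweR.
- by rewrite invr_ge0.
- by apply: integral_ge0 => x _; exact: poweR_ge0.
rewrite (ge0_integral_mixture k nu nu' nuk _ mfr); last first.
  by move=> y; exact: poweR_ge0.
apply: ge0_le_integral => //.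
- by move=> x _; exact: poweR_ge0.
- apply/measurable_abse_poweR/measurable_kernel_fun => // A.
  exact: measurable_kernel.
- apply: measurable_fun_integral_kernel => //; last by move=> y; exact: poweR_ge0.
  by move=> A; exact: measurable_kernel.
move=> x _; apply: le_trans (poweR_integral_le _ _ _ (prob_kernel x) r1 mf).
by apply: ge0_le_poweR => //; exact: le_abse_integral.
Qed.

End kernel_fun.

(** * Reduction of norm bounds to bounded nonnegative functions *)

Section operator_norm.
Context {d d'} {X : measurableType d} {Y : measurableType d'} {R : realType}.
Variables (mu : {measure set Y -> \bar R}) (nu : {measure set X -> \bar R}).
Variables (k : X -> {measure set Y -> \bar R}) (p q : R).

Lemma Lnorm_kernel_fun_le1 (f : Y -> R) :
  operator_norm mu p%:E nu q%:E k <= 1 ->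
  measurable_fun [set: Y] f -> 'N[mu]_p%:E[EFin \o f] <= 1 ->
  'N[nu]_q%:E[kernel_fun k f] <= 1.
Proof.
move=> k1 mf f1; apply: le_trans k1; apply: ereal_sup_ubound.
exists f => //; split => //; apply/andP; split; rewrite inE//.
by rewrite /= /finite_norm (le_lt_trans f1)// ltry.
Qed.

Hypothesis mk : forall A, measurable A -> measurable_fun [set: X] (k ^~ A).
Hypotheses (p0 : (0 < p)%R) (q0 : (0 < q)%R).

(* Replace f by |f|, truncate it at height n and let n go to infinity. *)
Lemma operator_norm_le1_bounded :
  (forall (f : Y -> R) (c : R), measurable_fun [set: Y] f ->
    (forall y, 0 <= f y <= c)%R -> 'N[mu]_p%:E[EFin \o f] <= 1 ->
    'N[nu]_q%:E[kernel_fun k f] <= 1) ->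
  operator_norm mu p%:E nu q%:E k <= 1.
Proof.
move=> kbounded; apply: ge_ereal_sup => _ [f [/andP[/[!inE] mf _] f1] <-].
have {}mf : measurable_fun [set: Y] f by [].
have mnf : measurable_fun [set: Y] (fun y => `|f y|%R).
  exact: measurableT_comp.
pose g n y := Num.min `|f y|%R n%:R.
have mg n : measurable_fun [set: Y] (g n) by exact: measurable_minr.
have g0 n y : (0 <= g n y)%R by rewrite le_min normr_ge0 ler0n.
have nd_g y : {homo g ^~ y : m n / (m <= n)%N >-> (m <= n)%R}.
  move=> m n mn; rewrite /g le_min ge_min lexx/= ge_min.
  by apply/orP; right; rewrite ler_nat.
(* Once [n] exceeds [|f y|] the truncation is inactive: the sequence is eventually constant. *)
have cvg_g y : (g n y)%:E @[n --> \oo] --> `|f y|%:E.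
  apply: cvg_near_cst; near=> n.
  by congr EFin; apply: min_l; near: n; exact: nbhs_infty_ger.
have kg n : 'N[nu]_q%:E[kernel_fun k (g n)] <= 1.
  apply: (kbounded _ n%:R) => //.
    by move=> y; rewrite g0/= ge_min lexx orbT.
  apply: le_trans f1; apply: le_Lnorm; first exact: ltW.
  - exact/measurable_EFinP.
  - exact/measurable_EFinP.
  - by move=> y; rewrite /= lee_fin ger0_norm// ge_min lexx.
have nd_kg x : {homo (fun n => kernel_fun k (g n) x) :
    m n / (m <= n)%N >-> m <= n}.
  move=> m n mn; apply: ge0_le_integral => //.
  - by move=> y _; rewrite lee_fin.
  - exact/measurable_EFinP.
  - exact/measurable_EFinP.
  - by move=> y _; rewrite lee_fin; exact: nd_g.
have kg0 n x : 0 <= kernel_fun k (g n) x by exact: kernel_fun_ge0.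
have nd_kgq x : {homo (fun n => `|kernel_fun k (g n) x| `^ q) :
    m n / (m <= n)%N >-> m <= n}.
  move=> m n mn; apply: ge0_le_poweR; [exact: ltW|exact: abse_ge0|].
  by rewrite !gee0_abs//; exact: nd_kg.
(* The [q]-th root of the limit [l] bounds every [k (g n)] at [x], hence by monotone convergence
   [k |f|], which dominates [|k f|]. Raising to the power [q] gives back [l]. *)
have lekg x : `|kernel_fun k f x| `^ q <=
    limn (fun n => `|kernel_fun k (g n) x| `^ q).
  set l := limn _.
  have kgl n : kernel_fun k (g n) x <= l `^ q^-1.
    rewrite -(poweRe1 (kg0 n x)) -[X in _ `^ X](mulfV (lt0r_neq0 q0)) poweRrM.
    apply: ge0_le_poweR; [by rewrite invr_ge0 ltW|exact: poweR_ge0|].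
    rewrite -[kernel_fun k _ _]gee0_abs//.
    rewrite /l (cvg_lim _ (ereal_nondecreasing_cvgn (nd_kgq x)))//.
    by apply: ereal_sup_ubound; exists n.
  have l0 : 0 <= l.
    apply: lime_ge.
      by apply: ereal_nondecreasing_is_cvgn; exact: nd_kgq.
    by apply: nearW => n; exact: poweR_ge0.
  rewrite -[leRHS](poweRe1 l0) -[X in _ <= _ `^ X](mulVf (lt0r_neq0 q0)) poweRrM.
  apply: ge0_le_poweR; [exact: ltW|exact: abse_ge0|].
  apply: (@le_trans _ _ (\int[k x]_y `|f y|%:E)).
    exact/le_abse_integral/measurable_EFinP.
  rewrite (_ : \int[k x]_y _ = limn (fun n => kernel_fun k (g n) x)).
    apply: lime_le; first exact/ereal_nondecreasing_is_cvgn/nd_kg.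
    exact: nearW.
  rewrite /kernel_fun -monotone_convergence//.
  - by apply: eq_integral => y _; apply/esym/cvg_lim.
  - by move=> n; exact/measurable_EFinP.
  - by move=> n y _; rewrite lee_fin.
  - by move=> y _ m n mn; rewrite lee_fin; exact: nd_g.
have mkg n : measurable_fun [set: X] (fun x => `|kernel_fun k (g n) x| `^ q).
  exact/measurable_abse_poweR/measurable_kernel_fun.
rewrite Lnorm_le1//.
apply: (@le_trans _ _
    (\int[nu]_x limn (fun n => `|kernel_fun k (g n) x| `^ q))).
  apply: ge0_le_integral => //.
  - by move=> x _; exact: poweR_ge0.
  - exact/measurable_abse_poweR/measurable_kernel_fun.
  - apply: (emeasurable_fun_cvg (fun n x => `|kernel_fun k (g n) x| `^ q)) => //.
    by move=> x _; apply: ereal_nondecreasing_is_cvgn; exact: nd_kgq.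
(* The integral of the limit is the limit of the integrals, each at most 1 by [kg]. *)
rewrite monotone_convergence//.
- apply: lime_le.
    apply: ereal_nondecreasing_is_cvgn => m n mn; apply: ge0_le_integral => //.
    + by move=> x _; exact: poweR_ge0.
    + by move=> x _; exact: nd_kgq.
  by apply: nearW => n; rewrite -Lnorm_le1.
- by move=> n x _; exact: poweR_ge0.
Unshelve. all: by end_near. Qed.

End operator_norm.

(** * Factorization of the shifted semigroup *)

Section interweaving.
Context {d d' d0} {V : measurableType d} {V' : measurableType d'}
  {Omega : measurableType d0} {R : realType}.
Variables (P : markov_semigroup V R) (P' : markov_semigroup V' R).
Variables (Pr : probability Omega R) (tau : {RV Pr >-> R}).

(* [P_{t + tau} = P_t P_tau], by Fubini. *)
Lemma shifted_kernelE (t : R) (t0 : (0 <= t)%R) x A : measurable A ->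
  shifted_kernel P tau t0 x A =
  \int[P t x]_y \int[distribution Pr tau]_(s in `[0%R, +oo[) P s y A.
Proof.
move=> mA; pose D : set (measurableTypeR R) := `[0%R, +oo[%classic.
(* Joint measurability is available for nonnegative times only; extension by 0 makes the integrand
   measurable on the whole product, as Tonelli requires. *)
pose F := (fun sy : measurableTypeR R * V => P sy.1 sy.2 A) \_ (D `*` setT).
have FE s y : F (s, y) = ((fun s => P s y A) \_ D) s.
  by rewrite /F /patch in_setX in_setT andbT.
have F0 z : 0 <= F z by apply: erestrict_ge0 => *; exact: measure_ge0.
have mF : measurable_fun setT F.
  have mD : measurable (D `*` [set: V]) by rewrite /D; apply: measurableX.
  by apply/(measurable_restrictT _ mD); exact: semigroup_measurable.
transitivity (\int[distribution Pr tau]_s \int[kernel_giry (P t) x]_y F (s, y)).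
  rewrite /shifted_kernel/= /shifted_set_fun integral_mkcond.
  apply: eq_integral => s _.
  under [RHS]eq_integral do rewrite FE.
  rewrite /patch; case: ifPn => [|_]; last by rewrite integral0.
  rewrite inE/= in_itv/= andbT => s0.
  by rewrite -semigroup_comp.
have -> := @fubini_tonelli _ _ _ _ _ (distribution Pr tau)
  (kernel_giry (P t) x) F mF F0.
apply: eq_integral => y _; rewrite [RHS]integral_mkcond.
by apply: eq_integral => s _; exact: FE.
Qed.

Variables (L : R.-pker V ~> V') (L' : R.-pker V' ~> V).
Hypothesis PP' : interweaving P P' tau L L'.

(** The warm-up identity replaces [P_tau] by [L L'], then the left intertwining replaces [P_t L] by
    [L P'_t]. The mixture formula regroups the iterated integrals before and after this exchange. *)
Lemma shifted_kernel_interweaving (t : R) (t0 : (0 <= t)%R) x A :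
  measurable A ->
  shifted_kernel P tau t0 x A = \int[L x]_z kcomp_noparam (P' t) L' z A.
Proof.
move=> mA; have mL' : measurable_fun setT (L' ^~ A) by exact: measurable_kernel.
rewrite shifted_kernelE//.
under eq_integral do rewrite -(interweaving_warmup PP')//.
rewrite /kcomp_noparam.
rewrite -(ge0_integral_mixture L (kernel_giry (P t) x)
  (mkcomp_noparam (P t) L x))//.
rewrite (eq_measure_integral (mkcomp_noparam L (P' t) x)); last first.
  by move=> B mB _; exact: (interweaving_left PP').
by rewrite (ge0_integral_mixture (P' t) (kernel_giry L x)).
Qed.

(** The factorization presents the function as [L] applied to the measurable function
    [z |-> (P'_t L') z A]. *)
Lemma measurable_shifted_kernel (t : R) (t0 : (0 <= t)%R) A : measurable A ->
  measurable_fun [set: V] (shifted_kernel P tau t0 ^~ A).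
Proof.
move=> mA.
rewrite (_ : shifted_kernel P tau t0 ^~ A =
    fun x => \int[L x]_z mkcomp_noparam (P' t) L' z A); last first.
  by apply/funext => x; exact: shifted_kernel_interweaving.
apply: measurable_fun_integral_kernel => //.
- by move=> B mB; exact: measurable_kernel.
- exact: measurable_kernel.
Qed.

(** The shifted kernel is a mixture of [P'_t L'] under [L], and [P'_t L'] one of [L'] under [P'_t]:
    the mixture formula applies twice. *)
Lemma integral_shifted_kernel (t : R) (t0 : (0 <= t)%R) x (f : V -> \bar R) :
  measurable_fun [set: V] f -> (forall y, 0 <= f y) ->
  \int[shifted_kernel P tau t0 x]_y f y =
  \int[L x]_z \int[P' t z]_w \int[L' w]_y f y.
Proof.
move=> mf f0.
rewrite (ge0_integral_mixture (mkcomp_noparam (P' t) L') (kernel_giry L x)) //.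
  apply: eq_integral => z _.
  by rewrite (ge0_integral_mixture L' (kernel_giry (P' t) z)).
by move=> A mA; exact: shifted_kernel_interweaving.
Qed.

End interweaving.

Theorem theorem9 (R : realType) (d d' d0 : measure_display)
    (V : measurableType d) (V' : measurableType d')
    (Omega : measurableType d0) (Pr : probability Omega R)
    (P : markov_semigroup V R) (P' : markov_semigroup V' R)
    (nu : probability V R) (nu' : probability V' R)
    (tau : {RV Pr >-> R})
    (L : R.-pker V ~> V') (L' : R.-pker V' ~> V)
    (nu_inv : invariant_measure P nu) (nu'_inv : invariant_measure P' nu')
    (PP' : interweaving P P' tau L L')
    (nuL : forall A, measurable A -> nu' A = measure_kernel nu L A)
    (nu'L' : forall A, measurable A -> nu A = measure_kernel nu' L' A)
    (alpha : R) (alpha_gt0 : (0 < alpha)%R)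
    (hyper : forall t : R, (0 <= t)%R ->
      operator_norm nu' 2%:E nu' (hyper_exponent (alpha * t))%:E (P' t) <= 1) :
  forall (t : R) (t0 : (0 <= t)%R),
    operator_norm nu 2%:E nu (hyper_exponent (alpha * t))%:E
      (shifted_kernel P tau t0) <= 1.
Proof.
move=> t t0; have q1 : (1 < hyper_exponent (alpha * t))%R.
  by rewrite ltrDl expR_gt0.
have q0 := lt_trans ltr01 q1.
apply: operator_norm_le1_bounded => // [A|f c mf f0c f1].
  exact: (measurable_shifted_kernel _ _ _ _ _ _ PP').
(* [h] is [L' f] and [u] is [P'_t h], both real-valued with values between 0 and [c]. *)
have [h [mh h0c hE]] := bounded_kernel_fun L' f c mf f0c.
have [u [mu u0c uE]] := bounded_kernel_fun (P' t) h c mh h0c.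
have -> : kernel_fun (shifted_kernel P tau t0) f = kernel_fun L u.
  apply/funext => x; rewrite /kernel_fun (integral_shifted_kernel _ _ _ _ _ _ PP')//.
  - apply: eq_integral => z _; rewrite -[RHS]/((EFin \o u) z) -uE.
    by apply: eq_integral => w _; rewrite -[RHS]/((EFin \o h) w) -hE.
  - exact/measurable_EFinP.
  - by move=> y; rewrite lee_fin; case/andP: (f0c y).
(* Three bounds in turn: [L] contracts from the target exponent over [nu'] to the same exponent over
   [nu], [hyper] handles [P'_t], and [L'] contracts from exponent 2 over [nu] to exponent 2 over
   [nu']. *)
apply: le_trans (Lnorm_kernel_fun_le L nu nu' _ _ nuL q1 mu) _.
rewrite -uE; apply: Lnorm_kernel_fun_le1 (hyper _ t0) mh _.
rewrite -hE; apply: le_trans f1.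
by apply: (Lnorm_kernel_fun_le L' nu' nu); rewrite // ltr1n.
Qed.
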